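(* Let $u$ satisfy $u_t(x,t)=\sum_{k=1}^Kc_k(x,t)f_k(x,t)$ on $\Omega\times[0,T]$ for a dictionary $\mathcal{F}=\{f_k\}_{k=1}^K$ and coefficient functions $c_k$. Let $\varepsilon>0$, suppose the coefficients are admissible at some point $(x_0,t_0)$, i.e. $c_k(x_0,t_0)\in\mathcal{C}_\varepsilon$ for all $k$, and let $B$ be a neighborhood of $(x_0,t_0)$. Let $\mathcal{A}=\{k: c_k(x_0,t_0)\ne0\}$. Let $\{\overline c_k^*\}_{k=1}^K$ be an optimal set of constant coefficients, i.e. $$\{\overline c_k^*\}_{k=1}^K=\arg\min_{\overline c_k\in\mathcal{C}_\varepsilon}\left\|\sum_{k=1}^K\left(\overline c_k-c_k(y,\tau)\right)f_k(y,\tau)\right\|_{L^\infty(B)},$$ and let $\mathcal{A}^*=\{k:\overline c_k^*\ne0\}$. Then $\mathcal{A}=\mathcal{A}^*$ if the patch size $R=\mathrm{diam}(B)$ satisfies $$\mathcal{K}_B^{\mathcal{F}}>\frac{2LR}{\varepsilon},$$ where $L$ is the Lipschitz constant for all $c_k(x,t)$.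
   Context: $f_k:\Omega\times[0,T]\to\mathbb{R}$ are given features (partial derivatives of $u$ in space and functions of these) and $c_k:\Omega\times[0,T]\to\mathbb{R}$. The admissible set is $\mathcal{C}_\varepsilon=(-\infty,-\varepsilon)\cup\{0\}\cup(\varepsilon,\infty)$. The condition constant of the data on $B\subset\Omega\times[0,T]$ is $$\mathcal{K}_B^{\mathcal{F}}=\frac{\inf_{\|\hat{\mathbf{c}}\|_\infty=1}\left\|\sum_{k=1}^K\hat c_kf_k(y,\tau)\right\|_{L^\infty(B)}}{\sup_{\|\hat{\mathbf{c}}\|_\infty=1}\left\|\sum_{k=1}^K\hat c_kf_k(y,\tau)\right\|_{L^\infty(B)}},\qquad\hat{\mathbf{c}}=(\hat c_k)\in\mathbb{R}^K,$$ where $(y,\tau)$ denotes the variable in $B$ over which the $L^\infty(B)$ norm is taken. $L$ is a common Lipschitz constant of all $c_k$ in $(x,t)$. *)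

(* Defs.v *)
From HB Require Import structures.
From mathcomp Require Import all_boot all_order all_algebra.
From mathcomp Require Import all_classical all_reals all_analysis.
Set Implicit Arguments.
Unset Strict Implicit.
Unset Printing Implicit Defensive.
Import Order.TTheory GRing.Theory Num.Theory.
Import numFieldNormedType.Exports.
Local Open Scope classical_set_scope.
Local Open Scope ring_scope.

(** * Lebesgue measure on R^n

    The library has Lebesgue measure on the line and binary product measures.
    Row vectors get the sigma-algebra generated by their coordinates, and the
    Lebesgue measure on R^(n+1) is the image of the product of those on R and
    R^n; [rV_lebesgue_box] is the expected value on boxes. *)

Section measurable_rV.
Variables (R : realType) (n : nat).

Definition rV_coord (i : 'I_n) (v : 'rV[R]_n) : R := v ord0 i.

Let rV_set0 : g_sigma_preimage rV_coord set0.
Proof. exact: sigma_algebra0. Qed.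

Let rV_setC A : g_sigma_preimage rV_coord A -> g_sigma_preimage rV_coord (~` A).
Proof. exact: sigma_algebraC. Qed.

Let rV_bigcup (F : (set 'rV[R]_n)^nat) :
  (forall i, g_sigma_preimage rV_coord (F i)) ->
  g_sigma_preimage rV_coord (\bigcup_i (F i)).
Proof. exact: sigma_algebra_bigcup. Qed.

HB.instance Definition _ := @isMeasurable.Build default_measure_display
  'rV[R]_n (g_sigma_preimage rV_coord) rV_set0 rV_setC rV_bigcup.

End measurable_rV.

Lemma measurable_rV_coord (R : realType) n (i : 'I_n) :
  measurable_fun [set: 'rV[R]_n] (@rV_coord R n i).
Proof.
move=> _ Y mY; rewrite setTI; apply: sub_sigma_algebra => /=.
rewrite -bigcup_seq/=; exists i => /=; first by rewrite mem_index_enum.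
by exists Y => //; rewrite setTI.
Qed.

Lemma measurable_fun_rVP d (T : measurableType d) (R : realType) n
    (f : T -> 'rV[R]_n) :
  (forall i, measurable_fun [set: T] (fun x => f x ord0 i)) ->
  measurable_fun [set: T] f.
Proof.
move=> mf; apply: (@measurability _ _ _ _ setT f
  (\big[setU/set0]_(i < n) preimage_set_system setT (@rV_coord R n i) measurable)) => //.
move=> _ [B + <-]; rewrite -bigcup_seq => -[i _ [A mA <-]].
by have := mf i measurableT A mA; rewrite !setTI.
Qed.

Definition rV_cons (R : realType) n (p : R * 'rV[R]_n) : 'rV[R]_n.+1 :=
  \row_i (if unlift ord0 i is Some j then p.2 ord0 j else p.1).

Definition rV_uncons (R : realType) n (v : 'rV[R]_n.+1) : R * 'rV[R]_n :=
  (v ord0 ord0, \row_j v ord0 (lift ord0 j)).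

Lemma rV_cons0 (R : realType) n (p : R * 'rV[R]_n) :
  rV_cons p ord0 ord0 = p.1.
Proof. by rewrite mxE unlift_none. Qed.

Lemma rV_consS (R : realType) n (p : R * 'rV[R]_n) j :
  rV_cons p ord0 (lift ord0 j) = p.2 ord0 j.
Proof. by rewrite mxE liftK. Qed.

Lemma rV_consK (R : realType) n : cancel (@rV_cons R n) (@rV_uncons R n).
Proof.
case=> r v; rewrite /rV_uncons rV_cons0; congr (_, _).
by apply/rowP => j; rewrite mxE rV_consS.
Qed.

Lemma measurable_rV_cons (R : realType) n :
  measurable_fun [set: R * 'rV[R]_n] (@rV_cons R n).
Proof.
apply: measurable_fun_rVP => i; case: (unliftP ord0 i) => [j|] ->.
  under eq_fun do rewrite rV_consS.
  exact: (measurableT_comp (measurable_rV_coord j) measurable_snd).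
under eq_fun do rewrite rV_cons0.
exact: measurable_fst.
Qed.

Lemma measurable_rV_uncons (R : realType) n :
  measurable_fun [set: 'rV[R]_n.+1] (@rV_uncons R n).
Proof.
apply/measurable_fun_pairP; split; first exact: (measurable_rV_coord ord0).
apply: measurable_fun_rVP => i; rewrite /rV_uncons /=.
under eq_fun do rewrite mxE.
exact: (measurable_rV_coord (lift ord0 i)).
Qed.

Section rV_lebesgue.
Variable R : realType.
Local Open Scope ereal_scope.

Section step.
Variables (n : nat) (mu : {sigma_finite_measure set 'rV[R]_n -> \bar R}).

Definition rV_lebesgue_succ : set 'rV[R]_n.+1 -> \bar R :=
  pushforward ((@lebesgue_measure R) \x mu) (@rV_cons R n).

Let rV_lebesgue_succ0 : rV_lebesgue_succ set0 = 0.
Proof. by rewrite /rV_lebesgue_succ /pushforward preimage_set0 measure0. Qed.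

Let rV_lebesgue_succ_ge0 A : 0 <= rV_lebesgue_succ A.
Proof. by rewrite /rV_lebesgue_succ /pushforward measure_ge0. Qed.

Let rV_lebesgue_succ_sigma_additive : semi_sigma_additive rV_lebesgue_succ.
Proof.
have mV A : measurable A -> measurable (@rV_cons R n @^-1` A).
  by move=> mA; rewrite -[X in measurable X]setTI; exact: measurable_rV_cons.
move=> F mF tF mUF; rewrite /rV_lebesgue_succ /pushforward preimage_bigcup.
apply: measure_semi_sigma_additive.
- by move=> k; exact: mV.
- apply/trivIsetP => /= i j _ _ ij; rewrite -preimage_setI.
  by move/trivIsetP : tF => /(_ _ _ _ _ ij) ->//; rewrite preimage_set0.
- by rewrite -preimage_bigcup; exact: mV.
Qed.

HB.instance Definition _ := isMeasure.Build _ _ _ rV_lebesgue_succ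
  rV_lebesgue_succ0 rV_lebesgue_succ_ge0 rV_lebesgue_succ_sigma_additive.

Let rV_lebesgue_succ_sigma_finite : sigma_finite setT rV_lebesgue_succ.
Proof.
have /sigma_finiteP[F [TF ndF Foo]] := sigma_finiteT (@lebesgue_measure R).
have /sigma_finiteP[G [TG ndG Goo]] := sigma_finiteT mu.
exists (fun k => @rV_uncons R n @^-1` (F k `*` G k)).
  apply/seteqP; split=> // v _.
  have [i _ Fi] : (\bigcup_k F k) (rV_uncons v).1 by rewrite -TF.
  have [j _ Gj] : (\bigcup_k G k) (rV_uncons v).2 by rewrite -TG.
  exists (maxn i j) => //; split.
  - by move: Fi; exact/subsetPset/ndF/leq_maxl.
  - by move: Gj; exact/subsetPset/ndG/leq_maxr.
move=> k; have [mF Fk] := Foo k; have [mG Gk] := Goo k; split.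
  rewrite -[X in measurable X]setTI; apply: measurable_rV_uncons => //.
  exact: measurableX.
rewrite /rV_lebesgue_succ /pushforward -comp_preimage.
rewrite (_ : _ \o _ = id) ?preimage_id; last by apply/funext => p; exact: rV_consK.
by rewrite product_measure1E// lte_mul_pinfty// ge0_fin_numE.
Qed.

HB.instance Definition _ := Measure_isSigmaFinite.Build _ _ _ rV_lebesgue_succ
  rV_lebesgue_succ_sigma_finite.

End step.

Fixpoint rV_lebesgue (n : nat) : {sigma_finite_measure set 'rV[R]_n -> \bar R} :=
  match n with
  | 0%N => \d_(0%R : 'rV[R]_0)
  | m.+1 => rV_lebesgue_succ (rV_lebesgue m)
  end.

Lemma measurable_rV_box n (A : 'I_n -> set R) : (forall i, measurable (A i)) ->
  measurable [set v : 'rV[R]_n | forall i, A i (v ord0 i)].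
Proof.
move=> mA; rewrite (_ : mkset _ = \bigcap_(i in setT) (@rV_coord R n i @^-1` A i)).
  apply: fin_bigcap_measurable => [|i _]; first exact: finite_finset.
  by rewrite -[X in measurable X]setTI; exact: measurable_rV_coord.
by apply/seteqP; split => v /= h i; [move=> _; exact: h|exact: (h i I)].
Qed.

Lemma rV_lebesgue_box n (A : 'I_n -> set R) : (forall i, measurable (A i)) ->
  rV_lebesgue n [set v : 'rV[R]_n | forall i, A i (v ord0 i)] =
  \prod_(i < n) lebesgue_measure (A i).
Proof.
elim: n A => [|n IHn] A mA.
  by rewrite big_ord0 /= diracE mem_set// => -[].
rewrite big_ord_recl -(IHn (fun i => A (lift ord0 i)))//=.
have mB := measurable_rV_box (fun i => mA (lift ord0 i)).
rewrite /rV_lebesgue_succ /pushforward -product_measure1E//; last exact: (mA ord0).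
congr (_ _); apply/seteqP; split => [p /= h|p /= [h0 hS] i].
  by split=> [|i]; [rewrite -rV_cons0|rewrite -rV_consS].
by case: (unliftP ord0 i) => [j|] ->; rewrite ?rV_consS ?rV_cons0.
Qed.

End rV_lebesgue.

(** * Space-time patches

    Points of R^d x R are pairs (x, t). Functions on Omega x [0, T] are total
    functions on R^d x R whose values elsewhere are never used. *)

Section spacetime.
Context {R : realType} {d : nat}.
Implicit Types (p q : 'rV[R]_d * R) (B D : set ('rV[R]_d * R)).

Definition cylinder (Omega : set 'rV[R]_d) (T : R) : set ('rV[R]_d * R) :=
  Omega `*` `[0, T]%classic.

(* The norm instances of the library on row vectors and pairs are sup norms,
   hence an explicit Euclidean distance. *)
Definition euclid_dist p q : R :=
  Num.sqrt ((\sum_(i < d) (p.1 ord0 i - q.1 ord0 i) ^+ 2) + (p.2 - q.2) ^+ 2).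

Definition diam B : \bar R :=
  ereal_sup [set (euclid_dist p q)%:E | p in B & q in B].

Definition lipschitz_const D (L : R) (g : 'rV[R]_d * R -> R) : Prop :=
  0 <= L /\ forall p q, D p -> D q -> `|g p - g q| <= L * euclid_dist p q.

Definition spacetime_lebesgue :
    {measure set ('rV[R]_d * measurableTypeR R) -> \bar R} :=
  (rV_lebesgue R d \x @lebesgue_measure R)%E.

(* Cutting g off by 0 outside B does not change the essential supremum of |g|
   over B. *)
Definition Linfty_norm B (g : 'rV[R]_d * R -> R) : \bar R :=
  ('N[spacetime_lebesgue]_+oo [EFin \o (g \_ B)])%E.

(* Derivative in t within [0, T], so one-sided at t = 0 and t = T. *)
Definition is_time_derivative (T : R) (u : 'rV[R]_d * R -> R) p (l : R) : Prop :=
  (u (p.1, s) - u p) / (s - p.2) @[s --> within `[0, T] p.2^'] --> l.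

End spacetime.

Section dictionary.
Context {R : realType} {d K : nat}.
Implicit Types (B : set ('rV[R]_d * R)) (f c : 'I_K -> 'rV[R]_d * R -> R).

Definition admissible (eps : R) : set R :=
  `]-oo, - eps[%classic `|` [set 0] `|` `]eps, +oo[%classic.

(* `|ch| is the sup norm of the coefficient vector ch. In the degenerate cases
   the quotient of extended reals is 0: both 0 / 0 and x / +oo give 0. *)
Definition condition_constant B f : \bar R :=
  let norms := [set Linfty_norm B (fun p => \sum_(k < K) ch ord0 k * f k p)
               | ch in [set ch : 'rV[R]_K | `|ch| = 1]] in
  (ereal_inf norms / ereal_sup norms)%E.

Definition patch_residual B f c (cb : 'rV[R]_K) : \bar R :=
  Linfty_norm B (fun p => \sum_(k < K) (cb ord0 k - c k p) * f k p).

Definition optimal_constant_coefficients (eps : R) B f c (cs : 'rV[R]_K) : Prop :=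
  (forall k, admissible eps (cs ord0 k)) /\
  forall cb : 'rV[R]_K, (forall k, admissible eps (cb ord0 k)) ->
    (patch_residual B f c cs <= patch_residual B f c cb)%E.

End dictionary.

(* Main.v *)
Require Import Defs.
From mathcomp Require Import all_boot all_order all_algebra.
From mathcomp Require Import all_classical all_reals all_analysis.
From mathcomp Require Import ess_sup_inf ring.
Import Order.TTheory GRing.Theory Num.Theory.
Import numFieldNormedType.Exports.
Local Open Scope classical_set_scope.
Local Open Scope ring_scope.

(** Write v for the coefficient vector at (x0, t0), and let I and S be the
    infimum and the supremum of the L^oo(B) norm of the combinations of the
    features over coefficient vectors of sup norm 1, so that the condition
    constant is I / S.

    The vector v competes in the minimisation problem. Its residual is small: on
    B, whose diameter is R, the coefficients move by at most L R, and
    the sum of the |f_k| is essentially bounded by S, because that sum is, point by point, a combination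
    of the f_k with coefficients +1 and -1 ([ae_sum_norm_le]). So the residual of
    v, and by optimality that of cs, is at most L R S. By the triangle
    inequality the combination with coefficients cs - v has norm at most 2 L R S,
    while by homogeneity it has norm at least I * `|cs - v|
    ([near_optimal_coefficients_close]). The hypothesis on the condition constant
    then gives `|cs - v| <= eps. This forces the supports to agree, since an
    admissible nonzero number lies farther than eps from 0
    ([admissible_support_gap]). *)

Lemma ler_rV_norm (R : realType) (n : nat) (v : 'rV[R]_n) (k : 'I_n) :
  `|v ord0 k| <= `|v|.
Proof.
rewrite [leRHS]/Num.norm /= mx_normrE.
exact: (le_bigmax _ (fun i : 'I_1 * 'I_n => `|v i.1 i.2|) (ord0, k)).
Qed.

Lemma rV_norm_eq1 (R : realType) (n : nat) (v : 'rV[R]_n) (k : 'I_n) :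
  (forall i, `|v ord0 i| = 1) -> `|v| = 1.
Proof.
move=> v1; apply/eqP; rewrite eq_le -{2}(v1 k) ler_rV_norm andbT.
rewrite [leLHS]/Num.norm /= mx_normrE; apply/bigmax_leP; split => // -[i j] _ /=.
by rewrite ord1 v1.
Qed.

Section patch.
Context {R : realType} {d : nat}.
Implicit Types (B : set ('rV[R]_d * R)) (g : 'rV[R]_d * R -> R).

Local Notation mu := (@spacetime_lebesgue R d).

(** Nonnegativity of M takes care of the points outside B, where the function
    is cut off to 0. *)
Lemma Linfty_norm_leP B g (M : R) : 0 <= M ->
  (Linfty_norm B g <= M%:E)%E <-> {ae mu, forall p, B p -> `|g p| <= M}.
Proof.
move=> M0; rewrite /Linfty_norm unlock.
have aeE : (\forall p \ae mu, ((abse \o (EFin \o (g \_ B))) p <= M%:E)%E) <->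
    {ae mu, forall p, B p -> `|g p| <= M}.
  split; apply: (@filterS _ (almost_everywhere mu)) => p /=.
    by move=> + Bp; rewrite patchE mem_set// lee_fin.
  move=> gM; rewrite patchE lee_fin; case: ifPn => [/set_mem/gM//|_].
  by rewrite normr0.
case: ifPn => [_|]; first by split=> [/ess_supP/aeE|/aeE/ess_supP].
rewrite -leNgt => mu0; split=> _; last by rewrite lee_fin.
(* Over a null measure the norm is 0 and every set is negligible. *)
exists setT; split => //.
by apply/eqP; rewrite eq_le measure_ge0 andbT; exact: mu0.
Qed.

Lemma Linfty_norm_ge0 B g : (0 <= Linfty_norm B g)%E.
Proof. exact: Lnorm_ge0. Qed.

End patch.

Section dictionary.
Context {R : realType} {d K : nat}.
Variables (B : set ('rV[R]_d * R)) (f : 'I_K -> 'rV[R]_d * R -> R).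

Local Notation mu := (@spacetime_lebesgue R d).
Local Notation norm_comb ch :=
  (Linfty_norm B (fun p => \sum_(k < K) ch ord0 k * f k p)).

(** At a given point the sum of the |f_k| is the combination whose coefficients
    are the signs of the f_k there. The pattern of signs varies with the point,
    but there are finitely many of them, so the exceptional null sets can be
    united. *)
Lemma ae_sum_norm_le (S : R) (k0 : 'I_K) : 0 <= S ->
  (forall ch : 'rV[R]_K, `|ch| = 1 -> (norm_comb ch <= S%:E)%E) ->
  {ae mu, forall p, B p -> \sum_(k < K) `|f k p| <= S}.
Proof.
move=> S0 combS.
pose ch (s : {ffun 'I_K -> bool}) : 'rV[R]_K := \row_k (-1) ^+ s k.
have : {ae mu, forall p, forall s, B p ->
    `|\sum_(k < K) ch s ord0 k * f k p| <= S}.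
  apply: (@filter_forall _ _ _ (almost_everywhere mu)) => s; apply/Linfty_norm_leP => //; apply: combS.
  by apply: (@rV_norm_eq1 _ _ _ k0) => k; rewrite mxE normrX normrN1 expr1n.
apply: (@filterS _ (almost_everywhere mu)) => p.
move=> /(_ [ffun k => f k p < 0]) + Bp => /(_ Bp); apply: le_trans.
rewrite (le_trans _ (ler_norm _))// ler_sum// => k _.
by rewrite mxE ffunE -normrEsign// num_real.
Qed.

(** A condition constant above a nonnegative bound is a genuine quotient of real
    numbers: the degenerate quotients 0 / 0 and x / +oo are 0. *)
Lemma condition_constant_gtP (k0 : 'I_K) (q : \bar R) :
  (0 <= q)%E -> (q < condition_constant B f)%E ->
  exists r I S : R, [/\ q = r%:E, 0 <= S, r * S < I &
    forall ch : 'rV[R]_K, `|ch| = 1 ->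
      (I%:E <= norm_comb ch)%E /\ (norm_comb ch <= S%:E)%E].
Proof.
rewrite /condition_constant; set N := [set _ | _ in _] => q0.
have bounds (ch : 'rV[R]_K) : `|ch| = 1 ->
    (ereal_inf N <= norm_comb ch)%E /\ (norm_comb ch <= ereal_sup N)%E.
  move=> ch1; have Nch : N (norm_comb ch) by exists ch.
  by split; [exact: ereal_inf_lbound|exact: ereal_sup_ubound].
have infN0 : (0 <= ereal_inf N)%E.
  by apply: le_ereal_inf_tmp => _ [ch _ <-]; exact: Linfty_norm_ge0.
have infN_le_supN : (ereal_inf N <= ereal_sup N)%E.
  have [|infch chsup] := bounds (const_mx 1); last exact: le_trans chsup.
  by apply: (@rV_norm_eq1 _ _ _ k0) => k; rewrite mxE normr1.
move: (ereal_inf N) (ereal_sup N) infN0 infN_le_supN bounds.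
move=> [I||] [S||] //; last 2 first.
- by move=> _ _ _; rewrite invey mule0 ltNge q0.
- by move=> _ _ _; rewrite invey mule0 ltNge q0.
rewrite !lee_fin => I0 IS bounds; rewrite inver.
have [S0|S0] := eqVneq S 0.
  have -> : I = 0 by apply/eqP; rewrite eq_le I0 -S0 IS.
  by rewrite mul0e ltNge q0.
case: q q0 => [r||]//; rewrite -EFinM lte_fin => r0 rIS; exists r, I, S.
have S_gt0 : 0 < S by rewrite lt_def S0 (le_trans I0).
by split; rewrite ?(ltW S_gt0)// -ltr_pdivlMr.
Qed.

(** The bound S turns closeness of v to c into a small residual of v, hence of
    cs; the bound I turns the small combination with coefficients cs - v, scaled
    to norm 1, back into closeness of cs to v. The factor 2 counts the two
    residuals. *)
Lemma near_optimal_coefficients_close (c : 'I_K -> 'rV[R]_d * R -> R)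
    (v cs : 'rV[R]_K) (r I S : R) : 0 <= r -> 0 <= S ->
  (forall p k, B p -> `|v ord0 k - c k p| <= r) ->
  (forall ch : 'rV[R]_K, `|ch| = 1 ->
     (I%:E <= norm_comb ch)%E /\ (norm_comb ch <= S%:E)%E) ->
  (patch_residual B f c cs <= patch_residual B f c v)%E ->
  I * `|cs - v| <= 2 * r * S.
Proof.
move=> r0 S0 vc combIS cs_le_v.
have [->|csv] := eqVneq cs v; first by rewrite subrr normr0 mulr0 !mulr_ge0.
have n0 : 0 < `|cs - v| by rewrite normr_gt0 subr_eq0.
have [k0 _] : exists k0 : 'I_K, true.
  have [k0 _|noK] := pickP (@predT 'I_K); first by exists k0.
  by case/eqP: csv; apply/rowP => k; have := noK k.
have rS0 : 0 <= r * S by rewrite mulr_ge0.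
have res_v : (patch_residual B f c v <= (r * S)%:E)%E.
  apply/Linfty_norm_leP => //.
  have := @ae_sum_norm_le S k0 S0 (fun ch ch1 => (combIS ch ch1).2).
  apply: (@filterS _ (almost_everywhere mu)) => p fS Bp.
  apply: le_trans (ler_wpM2l r0 (fS Bp)).
  rewrite mulr_sumr (le_trans (ler_norm_sum _ _ _))// ler_sum// => k _.
  by rewrite normrM ler_wpM2r// vc.
have /Linfty_norm_leP - /(_ rS0) ae_cs := le_trans cs_le_v res_v.
have /Linfty_norm_leP - /(_ rS0) ae_v := res_v.
pose w := `|cs - v|^-1 *: (cs - v).
have w1 : `|w| = 1 by rewrite normrZ normfV normr_id mulVf// gt_eqF.
rewrite -ler_pdivlMr// -lee_fin; apply: le_trans (combIS w w1).1 _.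
apply/Linfty_norm_leP; first by rewrite divr_ge0// -mulrA mulr_ge0.
apply: (@filterS2 _ (almost_everywhere mu)) ae_cs ae_v => p csp vp Bp.
(* The combination with coefficients cs - v is the difference of the functions
   whose norms are the two residuals. *)
have -> : \sum_(k < K) w ord0 k * f k p = `|cs - v|^-1 *
    (\sum_(k < K) (cs ord0 k - c k p) * f k p -
     \sum_(k < K) (v ord0 k - c k p) * f k p).
  rewrite -sumrB mulr_sumr; apply: eq_bigr => k _.
  by rewrite -mulrBl opprB addrA subrK !mxE mulrA.
rewrite normrM normfV normr_id mulrC ler_wpM2r ?invr_ge0//.
rewrite (le_trans (ler_normB _ _))// -mulrA mulrDl mul1r.
by rewrite lerD// ?csp ?vp.
Qed.

End dictionary.

Lemma admissible_norm_gt (R : realType) (eps x : R) :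
  admissible eps x -> x != 0 -> eps < `|x|.
Proof.
move=> [[|->]|]/=; rewrite ?eqxx// in_itv/= ?andbT => xeps _.
- by rewrite -normrN (lt_le_trans _ (ler_norm _))// ltrNr.
- by rewrite (lt_le_trans xeps)// ler_norm.
Qed.

Lemma admissible_support_gap (R : realType) (eps x y : R) :
  admissible eps x -> admissible eps y -> `|x - y| <= eps ->
  (x != 0) = (y != 0).
Proof.
move=> ax ay xy; have [x0|x0] := eqVneq x 0; have [y0|y0] := eqVneq y 0 => //.
- have := admissible_norm_gt _ _ _ ay y0; move: xy.
  by rewrite x0 sub0r normrN leNgt => /negPf ->.
- have := admissible_norm_gt _ _ _ ax x0; move: xy.
  by rewrite y0 subr0 leNgt => /negPf ->.
Qed.

Theorem theorem4p1 (R : realType) (d K : nat) (Omega : set 'rV[R]_d) (T : R)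
    (u : 'rV[R]_d * R -> R) (f c : 'I_K -> 'rV[R]_d * R -> R) (L eps : R)
    (x0 : 'rV[R]_d) (t0 : R) (B : set ('rV[R]_d * R)) (cs : 'rV[R]_K)
    (T_gt0 : 0 < T)
    (pde : forall p, cylinder Omega T p ->
      is_time_derivative T u p (\sum_(k < K) c k p * f k p))
    (c_lip : forall k, lipschitz_const (cylinder Omega T) L (c k))
    (eps_gt0 : 0 < eps)
    (p0_in : cylinder Omega T (x0, t0))
    (c_adm : forall k, admissible eps (c k (x0, t0)))
    (B_sub : B `<=` cylinder Omega T)
    (B_nbhs : within (cylinder Omega T) (nbhs (x0, t0)) B)
    (cs_opt : optimal_constant_coefficients eps B f c cs)
    (cond : (condition_constant B f > (2 * L)%:E * diam B / eps%:E)%E) :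
  [set k | c k (x0, t0) != 0] = [set k | cs ord0 k != 0].
Proof.
have Bp0 : B (x0, t0) by exact: (nbhs_singleton B_nbhs).
have [cs_adm cs_min] := cs_opt.
apply/seteqP; suff supp k : (c k (x0, t0) != 0) = (cs ord0 k != 0).
  by split=> k /=; rewrite supp.
have L0 : 0 <= L by have [] := c_lip k.
have dist_diam p : B p -> ((euclid_dist (x0, t0) p)%:E <= diam B)%E.
  by move=> Bp; apply: ereal_sup_ubound; exists (x0, t0) => //; exists p.
have diam0 : (0 <= diam B)%E.
  by apply: le_trans (dist_diam _ Bp0); rewrite lee_fin sqrtr_ge0.
move: cond; rewrite inver gt_eqF// => cond.
have bound0 : (0 <= (2 * L)%:E * diam B * eps^-1%:E)%E.
  by rewrite !mule_ge0// lee_fin ?mulr_ge0// invr_ge0 ltW.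
have [q [I [S [qE S0 qSI combIS]]]] := condition_constant_gtP _ _ k _ bound0 cond.
have q0 : 0 <= q by rewrite -lee_fin -qE.
(* The product is finite even when the diameter of B is not: then L = 0. *)
have LdiamE : (L%:E * diam B = (q * eps / 2)%:E)%E.
  rewrite -mulrA EFinM -qE -muleA -EFinM muleAC -EFinM; congr (_%:E * _)%E.
  by field; rewrite gt_eqF.
pose v : 'rV[R]_K := \row_i c i (x0, t0).
have vc p i : B p -> `|v ord0 i - c i p| <= q * eps / 2.
  move=> Bp; rewrite mxE; have [_ lip] := c_lip i.
  apply: le_trans (lip _ _ (B_sub _ Bp0) (B_sub _ Bp)) _.
  by rewrite -lee_fin -LdiamE EFinM lee_wpmul2l// ?lee_fin// dist_diam.
have r0 : 0 <= q * eps / 2 by rewrite !mulr_ge0// ltW.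
have cs_le_v : (patch_residual B f c cs <= patch_residual B f c v)%E.
  by apply: cs_min => i; rewrite mxE.
have := near_optimal_coefficients_close _ _ _ _ _ _ _ _ r0 S0 vc combIS cs_le_v.
rewrite (_ : 2 * _ * S = q * S * eps); last by field.
move=> close; have I0 : 0 < I by apply: le_lt_trans qSI; rewrite mulr_ge0.
apply: (admissible_support_gap _ eps) => //; rewrite distrC.
have := ler_rV_norm _ _ (cs - v) k; rewrite !mxE => /le_trans; apply.
by rewrite -(ler_pM2l I0) (le_trans close)// ler_wpM2r ?ltW.
Qed.
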